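(* Let $T=(\Sigma,\mathcal{R})$ be a graph transformation system and $\mathcal{D}\subseteq\mathcal{G}(\Sigma)$ a graph language. If all $\mathcal{D}$-non-garbage critical pairs of $T$ are strongly joinable, then $T$ is locally confluent up to garbage on $\mathcal{D}$.
   Context: A signature $\Sigma=(\Sigma_V,\Sigma_E)$ is a pair of finite label sets; a graph over $\Sigma$ is $G=(V,E,s,t,l,m)$ with finite node and edge sets, source/target maps $s,t:E\to V$ and labellings $l:V\to\Sigma_V$, $m:E\to\Sigma_E$; morphisms preserve incidence and labels; $\mathcal{G}(\Sigma)$ is the class of all graphs over $\Sigma$; $H\subseteq G$ means $H$ is a subgraph of $G$. A graph language is an isomorphism-closed class of graphs; $\widehat{\mathcal{D}}$ is the smallest language containing $\mathcal{D}$ that is closed under taking subgraphs. A rule is a pair of inclusions $r=\langle L\leftarrow K\rightarrow R\rangle$; a graph transformation (GT) system $T=(\Sigma,\mathcal{R})$ has a finite set $\mathcal{R}$ of rules. A direct derivation $G\Rightarrow_{r,g}H$ applies $r$ at an injective match $g:L\to G$ by a double pushout $L\leftarrow K\rightarrow R$ over $G\xleftarrow{in}D\xrightarrow{in'}H$ (it exists iff the dangling condition holds; $D,H$ are unique up to isomorphism). $G\Rightarrow_\mathcal{R}H$ if $H$ arises by applying some rule of $\mathcal{R}$; $G\Rightarrow^*_\mathcal{R}H$ if $G\cong H$ or $H$ arises by one or more steps. The track morphism of $G\Rightarrow H$ is the partial morphism $in'\circ in^{-1}$, composed along derivations. Two direct derivations $H_1\Leftarrow_{r_1,g_1}G\Rightarrow_{r_2,g_2}H_2$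 are parallelly independent if $g_1(L_1)\cap g_2(L_2)\subseteq g_1(K_1)\cap g_2(K_2)$; they form a critical pair if they are not parallelly independent, $G=g_1(L_1)\cup g_2(L_2)$, and $g_1\neq g_2$ when $r_1=r_2$. The persistent nodes of a critical pair are the nodes $v$ of $G$ whose track under both $G\Rightarrow H_1$ and $G\Rightarrow H_2$ is defined. The critical pair is strongly joinable if there is a graph $M$ and derivations $H_1\Rightarrow^*_\mathcal{R}M\Leftarrow^*_\mathcal{R}H_2$ such that for every persistent node $v$, the tracks of $v$ along $G\Rightarrow H_1\Rightarrow^*M$ and along $G\Rightarrow H_2\Rightarrow^*M$ are both defined and equal. It is $\mathcal{D}$-non-garbage if $G\in\widehat{\mathcal{D}}$. $T$ is locally confluent up to garbage on $\mathcal{D}$ if for all $G\in\mathcal{D}$, $H_1\Leftarrow_\mathcal{R}G\Rightarrow_\mathcal{R}H_2$ implies there is $M$ with $H_1\Rightarrow^*_\mathcal{R}M\Leftarrow^*_\mathcal{R}H_2$. *)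

(* Defs.v *)
From mathcomp Require Import all_boot.

Set Implicit Arguments.
Unset Strict Implicit.
Unset Printing Implicit Defensive.

Record signature := Signature {
  node_label : finType;
  edge_label : finType
}.

Record graph (S : signature) := Graph {
  node : finType;
  edge : finType;
  src : edge -> node;
  tgt : edge -> node;
  nlab : node -> node_label S;
  elab : edge -> edge_label S
}.

Record hom (S : signature) (G H : graph S) := Hom {
  homV :> node G -> node H;
  homE : edge G -> edge H;
  hom_src : forall e, src (homE e) = homV (src e);
  hom_tgt : forall e, tgt (homE e) = homV (tgt e);
  hom_nlab : forall v, nlab (homV v) = nlab v;
  hom_elab : forall e, elab (homE e) = elab e
}.

Definition hom_comp (S : signature) (G H I : graph S)
    (g : hom H I) (f : hom G H) : hom G I.
Proof.
exists (homV g \o homV f) (homE g \o homE f) => x /=.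
- by rewrite !hom_src.
- by rewrite !hom_tgt.
- by rewrite !hom_nlab.
- by rewrite !hom_elab.
Defined.

Definition inj_hom (S : signature) (G H : graph S) (f : hom G H) : Prop :=
  injective (homV f) /\ injective (homE f).

Definition bij_hom (S : signature) (G H : graph S) (f : hom G H) : Prop :=
  bijective (homV f) /\ bijective (homE f).

Definition isomorphic (S : signature) (G H : graph S) : Prop :=
  exists f : hom G H, bij_hom f.

Record subgraph (S : signature) (G : graph S) := Subgraph {
  sub_node : {set node G};
  sub_edge : {set edge G};
  sub_src : forall e, e \in sub_edge -> src e \in sub_node;
  sub_tgt : forall e, e \in sub_edge -> tgt e \in sub_node
}.

Definition graph_of_subgraph (S : signature) (G : graph S) (A : subgraph G) :
    graph S :=
  @Graph S {v : node G | v \in sub_node A} {e : edge G | e \in sub_edge A}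
    (fun e => exist _ (src (val e)) (sub_src (valP e)))
    (fun e => exist _ (tgt (val e)) (sub_tgt (valP e)))
    (fun v => nlab (val v))
    (fun e => elab (val e)).

Record language (S : signature) := Language {
  lang_mem :> graph S -> Prop;
  lang_iso : forall G H, isomorphic G H -> lang_mem G -> lang_mem H
}.

Definition subgraph_closed (S : signature) (C : language S) : Prop :=
  forall G, C G -> forall A : subgraph G, C (graph_of_subgraph A).

Definition in_lang_hat (S : signature) (D : language S) (G : graph S) : Prop :=
  forall C : language S,
    (forall X, D X -> C X) -> subgraph_closed C -> C G.

Lemma lang_hat_iso (S : signature) (D : language S) (G H : graph S) :
  isomorphic G H -> in_lang_hat D G -> in_lang_hat D H.
Proof. by move=> GH hG C DC subC; apply: lang_iso GH _; apply: hG. Qed.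

(* The smallest language containing D and closed under taking subgraphs. *)
Definition lang_hat (S : signature) (D : language S) : language S :=
  Language (@lang_hat_iso S D).

(* The inclusions of the interface in both sides are given, as usual up to
   renaming of the items of the three graphs, by injective morphisms. *)
Record rule (S : signature) := Rule {
  lhs : graph S;
  interface : graph S;
  rhs : graph S;
  incl_l : hom interface lhs;
  incl_r : hom interface rhs;
  incl_l_inj : inj_hom incl_l;
  incl_r_inj : inj_hom incl_r
}.

Record gt_system := GTSystem {
  gts_sig :> signature;
  gts_rules : rule gts_sig -> Prop;
  gts_finite : exists (n : nat) (f : 'I_n -> rule gts_sig),
    forall r, gts_rules r <-> exists i, f i = r
}.

Definition is_pushout (S : signature) (K L D G : graph S)
    (b : hom K L) (d : hom K D) (g : hom L G) (i : hom D G) : Prop :=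
  hom_comp g b = hom_comp i d /\
  forall (Z : graph S) (p : hom L Z) (q : hom D Z),
    hom_comp p b = hom_comp q d ->
    exists! u : hom G Z, hom_comp u g = p /\ hom_comp u i = q.

(*   lhs <----- interface -----> rhs
      |            |             |
   dd_match     dd_ctx_map   dd_comatch
      v            v             v
      G <--dd_in- dd_ctx -dd_in'-> H   *)
Record dderivation (S : signature) (r : rule S) (G H : graph S) := DDerivation {
  dd_match : hom (lhs r) G;
  dd_match_inj : inj_hom dd_match;
  dd_ctx : graph S;
  dd_ctx_map : hom (interface r) dd_ctx;
  dd_comatch : hom (rhs r) H;
  dd_in : hom dd_ctx G;
  dd_in' : hom dd_ctx H;
  dd_po_l : is_pushout (incl_l r) dd_ctx_map dd_match dd_in;
  dd_po_r : is_pushout (incl_r r) dd_ctx_map dd_comatch dd_in'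
}.

(* Tracks are only ever evaluated at nodes, so only the node component of the
   partial morphism in' \o in^-1 is recorded.  dd_in is injective, being a
   pushout of incl_l r, so the preimage that is picked is the only one. *)
Definition dd_track (S : signature) (r : rule S) (G H : graph S)
    (d : dderivation r G H) (v : node G) : option (node H) :=
  omap (homV (dd_in' d)) [pick x : node (dd_ctx d) | homV (dd_in d) x == v].

Record step (T : gt_system) (G H : graph T) := Step {
  step_rule : rule T;
  step_mem : gts_rules step_rule;
  step_dd : dderivation step_rule G H
}.

Inductive steps (T : gt_system) (G : graph T) : graph T -> Type :=
| Steps1 (H : graph T) : step G H -> steps G H
| StepsS (H I : graph T) : steps G H -> step H I -> steps G I.

Inductive derivation (T : gt_system) (G H : graph T) : Type :=
| DerivIso (f : hom G H) : bij_hom f -> derivation G H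
| DerivSteps : steps G H -> derivation G H.

Fixpoint steps_track (T : gt_system) (G H : graph T) (d : steps G H) :
    node G -> option (node H) :=
  match d in steps _ H0 return node G -> option (node H0) with
  | Steps1 _ s => dd_track (step_dd s)
  | StepsS _ _ d' s => fun v => obind (dd_track (step_dd s)) (steps_track d' v)
  end.

Definition deriv_track (T : gt_system) (G H : graph T) (d : derivation G H) :
    node G -> option (node H) :=
  match d with
  | DerivIso f _ => fun v => Some (homV f v)
  | DerivSteps d' => steps_track d'
  end.

Definition derives1 (T : gt_system) (G H : graph T) : Prop :=
  inhabited (step G H).

Definition derives (T : gt_system) (G H : graph T) : Prop :=
  inhabited (derivation G H).

Section Pairs.
Variables (S : signature) (r1 r2 : rule S) (G H1 H2 : graph S).
Variables (d1 : dderivation r1 G H1) (d2 : dderivation r2 G H2).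
Let g1 := dd_match d1.
Let g2 := dd_match d2.

Definition parallelly_independent : Prop :=
  (forall v : node G,
    (exists x, homV g1 x = v) -> (exists x, homV g2 x = v) ->
    (exists x, homV g1 (homV (incl_l r1) x) = v) /\
    (exists x, homV g2 (homV (incl_l r2) x) = v)) /\
  (forall e : edge G,
    (exists x, homE g1 x = e) -> (exists x, homE g2 x = e) ->
    (exists x, homE g1 (homE (incl_l r1) x) = e) /\
    (exists x, homE g2 (homE (incl_l r2) x) = e)).

Definition jointly_surjective : Prop :=
  (forall v : node G, (exists x, homV g1 x = v) \/ (exists x, homV g2 x = v)) /\
  (forall e : edge G, (exists x, homE g1 x = e) \/ (exists x, homE g2 x = e)).

Definition critical_pair : Prop :=
  [/\ ~ parallelly_independent,
      jointly_surjective &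
      forall e : r1 = r2,
        eq_rect r1 (fun r => hom (lhs r) G) g1 r2 e <> g2].

Definition persistent (v : node G) : Prop :=
  dd_track d1 v <> None /\ dd_track d2 v <> None.

End Pairs.

Definition strongly_joinable (T : gt_system) (r1 r2 : rule T)
    (G H1 H2 : graph T)
    (d1 : dderivation r1 G H1) (d2 : dderivation r2 G H2) : Prop :=
  exists (M : graph T) (e1 : derivation H1 M) (e2 : derivation H2 M),
    forall v : node G, persistent d1 d2 v ->
      exists w : node M,
        obind (deriv_track e1) (dd_track d1 v) = Some w /\
        obind (deriv_track e2) (dd_track d2 v) = Some w.

Definition locally_confluent_up_to_garbage
    (T : gt_system) (D : language T) : Prop :=
  forall G H1 H2 : graph T, D G -> derives1 G H1 -> derives1 G H2 ->
    exists M : graph T, derives H1 M /\ derives H2 M.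

(* Main.v *)
(** Parallelly independent steps commute by the local Church-Rosser property, and
    two applications of one rule at one match have isomorphic results.  Otherwise
    restrict both steps to the union [G'] of the two matches: this is a critical
    pair, and [G'] lies in [lang_hat D] as a subgraph of a graph of [D], so the
    pair is strongly joinable.  By the dangling condition an edge outside [G'] only
    meets persistent nodes of [G'], so [G] is [G'] glued along its persistent nodes
    to a context [C] made of the items outside [G'].  A derivation on which the
    tracks of the gluing points are defined extends to the graphs with [C] glued in
    along these tracks.  As the two tracks of each persistent node coincide in the
    common reduct, both extended derivations end in the same graph. *)

From Stdlib Require Import FunctionalExtensionality Classical.
From mathcomp Require Import all_boot.
Require Import Defs.

Set Implicit Arguments.
Unset Strict Implicit.
Unset Printing Implicit Defensive.

(** * Pushouts of finite sets along injective maps *)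

Lemma inj_surj_bij (A B : finType) (f : A -> B) :
  injective f -> (forall y, exists x, f x = y) -> bijective f.
Proof. by move=> fI /fin_all_exists [g fK]; exists g => // x; apply: fI. Qed.

Section FunctionPushout.
Variables (K L D G : finType) (b : K -> L) (d : K -> D) (g : L -> G) (i : D -> G).

(** The elementwise form of a pushout of sets with injective legs into [G]: two subsets cover [G]
    and overlap only in the image of [K]. No test objects occur, so the facts below become element
    chases. *)
Definition fpo : Prop :=
  [/\ forall k, g (b k) = i (d k),
      injective g,
      injective i,
      forall v, (exists x, g x = v) \/ (exists y, i y = v) &
      forall x y, g x = i y -> exists k, b k = x /\ d k = y].

(** Every element of [G] comes from [L] or [D], which forces a value on it; injectivity and the
    overlap condition make the forced values agree. Besides nodes and edges, [Z] can also be a label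
    set. *)
Lemma fpo_univ (Z : Type) (p : L -> Z) (q : D -> Z) :
  fpo -> (forall k, p (b k) = q (d k)) ->
  exists u : G -> Z, (forall x, u (g x) = p x) /\ (forall y, u (i y) = q y).
Proof.
move=> [comm gI iI cov cap] pq.
have /fin_all_exists [u uP] : forall v, exists z : Z,
    (forall x, g x = v -> p x = z) /\ (forall y, i y = v -> q y = z).
  move=> v; case: (cov v) => [[x <-]|[y <-]].
  - exists (p x); split=> [x' /gI -> //|y /esym /cap [k [<- <-]]].
    by rewrite pq.
  - exists (q y); split=> [x /cap [k [<- <-]]|y' /iI -> //].
    by rewrite pq.
by exists u; split=> [x|y]; [case: (uP (g x)) => h _|case: (uP (i y)) => _ h];
  rewrite -(h _ erefl).
Qed.

Lemma fpo_ind (P : G -> Prop) :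
  fpo -> (forall x, P (g x)) -> (forall y, P (i y)) -> forall v, P v.
Proof. by move=> [_ _ _ cov _] Pg Pi v; case: (cov v) => [[x <-]|[y <-]]. Qed.

End FunctionPushout.

(** The pushout is built as [L] together with the elements of [D] outside the image of [d]. *)
Lemma fpo_exists (K L D : finType) (b : K -> L) (d : K -> D) :
  injective b -> injective d ->
  exists (G : finType) (g : L -> G) (i : D -> G), fpo b d g i.
Proof.
move=> bI dI; pose C : finType := {y : D | y \notin codom d}.
have /fin_all_exists [i iP] : forall y, exists z : L + C,
    (forall k, d k = y -> inl (b k) = z) /\ (forall c : C, val c = y -> inr c = z).
  move=> y; have [/codomP [k ->]|yd] := boolP (y \in codom d).
  - exists (inl (b k)); split=> [k' /dI -> //|c cE].
    by case/negP: (valP c); rewrite cE codom_f.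
  - exists (inr (exist _ y yd)); split=> [k kE|c cE].
    + by case/negP: yd; rewrite -kE codom_f.
    + by congr inr; apply: val_inj.
have id k : i (d k) = inl (b k) by case: (iP (d k)) => h _; rewrite -(h _ erefl).
have ic c : i (val c) = inr c by case: (iP (val c)) => _ h; rewrite -(h _ erefl).
have Dcase y : (exists k, d k = y) \/ (exists c : C, val c = y).
  have [/codomP [k ->]|yd] := boolP (y \in codom d); first by left; exists k.
  by right; exists (exist _ y yd).
exists (L + C)%type, inl, i; split.
- by move=> k; rewrite id.
- by move=> x y [].
- move=> y y'; case: (Dcase y) => [[k <-]|[c <-]];
    case: (Dcase y') => [[k' <-]|[c' <-]]; rewrite ?id ?ic => // -[].
  + by move/bI->.
  + by move->.
- move=> [x|c]; first by left; exists x.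
  by right; exists (val c).
- move=> x y; case: (Dcase y) => [[k <-]|[c <-]]; rewrite ?id ?ic => // -[->].
  by exists k.
Qed.

(** The mediating map in the opposite direction is the inverse, since both composites fix the
    elements coming from the two legs. *)
Lemma fpo_bij (K L D G H : finType) (b : K -> L) (d : K -> D)
    (g : L -> G) (i : D -> G) (g' : L -> H) (i' : D -> H) (u : G -> H) :
  fpo b d g i -> fpo b d g' i' ->
  (forall x, u (g x) = g' x) -> (forall y, u (i y) = i' y) -> bijective u.
Proof.
move=> po po' ug ui; have [comm _ _ _ _] := po.
have [u' [ug' ui']] := fpo_univ po' comm.
exists u'; [apply: (fpo_ind po)|apply: (fpo_ind po')] => z.
all: by rewrite ?(ug, ui, ug', ui') ?(ug, ui, ug', ui').
Qed.

Lemma fpo_comp_bij (K L D G H : finType) (b : K -> L) (d : K -> D)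
    (g : L -> G) (i : D -> G) (f : G -> H) :
  bijective f -> fpo b d g i -> fpo b d (f \o g) (f \o i).
Proof.
move=> fB [comm gI iI cov cap]; have fI := bij_inj fB; case: fB => f' f'K fK.
split=> /=.
- by move=> k; rewrite comm.
- exact: inj_comp.
- exact: inj_comp.
- move=> v; case: (cov (f' v)) => [[x xE]|[y yE]].
  + by left; exists x; rewrite xE fK.
  + by right; exists y; rewrite yE fK.
- by move=> x y /fI /cap.
Qed.

Lemma fpo_ctx_bij (K L D D' G : finType) (b : K -> L) (d : K -> D) (d' : K -> D')
    (g : L -> G) (i : D' -> G) (h : D -> D') :
  bijective h -> (forall k, h (d k) = d' k) -> fpo b d' g i -> fpo b d g (i \o h).
Proof.
move=> hB hd [comm gI iI cov cap]; have hI := bij_inj hB; case: hB => h' h'K hK.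
split=> //=.
- by move=> k; rewrite hd comm.
- exact: inj_comp.
- move=> v; case: (cov v) => [[x <-]|[y <-]]; first by left; exists x.
  by right; exists (h' y); rewrite hK.
- by move=> x y /cap [k [<- kE]]; exists k; split=> //; apply: hI; rewrite hd.
Qed.

Lemma fpo_sym (K L D G : finType) (b : K -> L) (d : K -> D)
    (g : L -> G) (i : D -> G) :
  fpo b d g i -> fpo d b i g.
Proof.
move=> [comm gI iI cov cap]; split=> //.
- by move=> v; case: (cov v); [right|left].
- by move=> y x /esym /cap [k [<- <-]]; exists k.
Qed.

Lemma fpo_paste (K L D G E H : finType) (b : K -> L) (d : K -> D)
    (g : L -> G) (i : D -> G) (e : D -> E) (h : G -> H) (j : E -> H) :
  fpo b d g i -> fpo i e h j -> fpo b (e \o d) (h \o g) j.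
Proof.
move=> [comm gI iI cov cap] [comm' hI jI cov' cap']; split=> //=.
- by move=> k; rewrite comm comm'.
- exact: inj_comp.
- move=> v; case: (cov' v) => [[w <-]|]; last by right.
  case: (cov w) => [[x <-]|[y <-]]; first by left; exists x.
  by right; exists (e y); rewrite comm'.
- move=> x z /cap' [y [/esym /cap [k [<- <-]] <-]].
  by exists k.
Qed.

(** Decomposition of pushouts: if the first square and the outer square are pushouts, so is the
    remaining one. The delicate point is injectivity of [u] on a pair from [R] and [D]: by the outer
    overlap condition and injectivity of [j], both come from one element of [K]. *)
Lemma fpo_cancel (K R D E D' H : finType) (c : K -> R) (k : K -> D)
    (p : R -> E) (q : D -> E) (j : D -> D') (m : R -> H) (i : D' -> H)
    (u : E -> H) :
  injective j -> fpo c k p q -> fpo c (j \o k) m i ->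
  (forall x, u (p x) = m x) -> (forall y, u (q y) = i (j y)) -> fpo j q i u.
Proof.
move=> jI [comm pI qI cov cap] [comm' mI iI cov' cap'] up uq.
have mix x y : m x = i (j y) -> p x = q y.
  by move/cap' => [z [<- /= /jI <-]].
split=> //.
- move=> a a'; case: (cov a) => [[x <-]|[y <-]]; case: (cov a') => [[x' <-]|[y' <-]];
    rewrite ?up ?uq.
  + by move/mI->.
  + exact: mix.
  + by move/esym/mix.
  + by move/iI/jI->.
- move=> v; case: (cov' v) => [[x <-]|]; last by left.
  by right; exists (p x).
- move=> y a; case: (cov a) => [[x <-]|[z <-]]; rewrite ?up ?uq.
  + by move/esym/cap' => [z [<- <-]]; exists (k z); rewrite comm.
  + by move/iI->; exists z.
Qed.

(** Stability under pullback along the injection [i2]. As [g] factors through [D2], the corner [L]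
    survives whole and only [D1] shrinks, to its intersection [D] with [D2]. *)
Lemma fpo_pullback (K L D1 D2 G D : finType) (b : K -> L) (d : K -> D1)
    (g : L -> G) (i1 : D1 -> G) (i2 : D2 -> G) (j1 : D -> D1) (j2 : D -> D2)
    (k : K -> D) (h : L -> D2) :
  injective i2 -> injective j1 -> injective j2 -> fpo b d g i1 ->
  (forall z, i1 (j1 z) = i2 (j2 z)) ->
  (forall x y, i1 x = i2 y -> exists z, j2 z = y) ->
  (forall x, i2 (h x) = g x) -> (forall x, j1 (k x) = d x) -> fpo b k h j2.
Proof.
move=> i2I j1I j2I [comm gI i1I cov cap] sq pb ih jk.
split=> //.
- by move=> x; apply: i2I; rewrite ih -sq jk comm.
- by move=> x y /(congr1 i2); rewrite !ih => /gI.
- move=> y; case: (cov (i2 y)) => [[x xE]|[x /pb]]; last by right.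
  by left; exists x; apply: i2I; rewrite ih.
- move=> x z /(congr1 i2); rewrite ih -sq => /cap [a [<- aE]].
  by exists a; split=> //; apply: j1I; rewrite jk.
Qed.

Definition sum_map (V X Y : Type) (f : X -> Y) (z : X + V) : Y + V :=
  match z with inl x => inl (f x) | inr v => inr v end.

Lemma sum_map_bij (V X Y : Type) (f : X -> Y) :
  bijective f -> bijective (@sum_map V X Y f).
Proof.
by case=> f' fK f'K; exists (sum_map f') => -[x|v] //=; rewrite ?fK ?f'K.
Qed.

(** The new elements enter the context and the result alike and stay disjoint from [L], so the
    overlap is unchanged. *)
Lemma fpo_sum (V K L D G : finType) (b : K -> L) (d : K -> D)
    (g : L -> G) (i : D -> G) :
  fpo b d g i ->
  fpo b (fun k => inl (d k) : D + V) (fun x => inl (g x) : G + V) (sum_map i).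
Proof.
move=> [comm gI iI cov cap]; split=> /=.
- by move=> k; rewrite comm.
- by move=> x y [/gI].
- by move=> [x|v] [x'|v'] //= [] => [/iI ->|->].
- move=> [w|v]; last by right; exists (inr v).
  case: (cov w) => [[x <-]|[y <-]]; first by left; exists x.
  by right; exists (inl y).
- by move=> x [y|v] //= [/cap [k [<- <-]]]; exists k.
Qed.

(** * Graph morphisms and pushouts of graphs *)

Section Graphs.
Variable S : signature.
Implicit Types G H K L D R X Y Z : graph S.

(** The four proof fields are equations in types with decidable equality, so their proofs are
    unique. *)
Lemma hom_ext G H (f g : hom G H) :
  homV f =1 homV g -> homE f =1 homE g -> f = g.
Proof.
case: f g => [fV fE p1 p2 p3 p4] [gV gE q1 q2 q3 q4] /=.
move=> /functional_extensionality eV /functional_extensionality eE.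
subst gV gE.
by congr Hom; apply: functional_extensionality_dep => x; apply: eq_irrelevance.
Qed.

(** Any choice of preimages is already a morphism: the injective [i] reflects incidence, and labels
    are read off in [G]. *)
Lemma hom_factor G D X (i : hom D G) (f : hom X G) :
  inj_hom i -> (forall v, exists y, homV i y = homV f v) ->
  (forall e, exists y, homE i y = homE f e) ->
  exists h : hom X D,
    (forall v, homV i (homV h v) = homV f v) /\
    (forall e, homE i (homE h e) = homE f e).
Proof.
move=> [iV iE] /fin_all_exists [hV hVP] /fin_all_exists [hE hEP].
have hs e : src (hE e) = hV (src e) by apply: iV; rewrite -hom_src hEP hVP hom_src.
have ht e : tgt (hE e) = hV (tgt e) by apply: iV; rewrite -hom_tgt hEP hVP hom_tgt.
have hn v : nlab (hV v) = nlab v by rewrite -(hom_nlab i) hVP hom_nlab.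
have he e : elab (hE e) = elab e by rewrite -(hom_elab i) hEP hom_elab.
by exists (Hom hs ht hn he).
Qed.

Definition hom_id G : hom G G.
Proof. by exists id id. Defined.

Lemma hom_factor_bij G D D' (i : hom D G) (i' : hom D' G) :
  inj_hom i -> inj_hom i' ->
  (forall v, (exists y, homV i y = v) <-> (exists y, homV i' y = v)) ->
  (forall e, (exists y, homE i y = e) <-> (exists y, homE i' y = e)) ->
  exists h : hom D D', bij_hom h /\ hom_comp i' h = i.
Proof.
move=> [iV iE] [iV' iE'] imV imE.
have [h [hV hE]] : exists h : hom D D',
    (forall v, homV i' (homV h v) = homV i v) /\
    (forall e, homE i' (homE h e) = homE i e).
  by apply: hom_factor => // x; [apply/imV|apply/imE]; exists x.
exists h; split; last exact: hom_ext.
split; apply: inj_surj_bij => x.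
- by move=> y /(congr1 (homV i')); rewrite !hV => /iV.
- have [|y yE] := (imV (homV i' x)).2; first by exists x.
  by exists y; apply: iV'; rewrite hV.
- by move=> y /(congr1 (homE i')); rewrite !hE => /iE.
- have [|y yE] := (imE (homE i' x)).2; first by exists x.
  by exists y; apply: iE'; rewrite hE.
Qed.

Lemma bij_hom_inj G H (f : hom G H) : bij_hom f -> inj_hom f.
Proof. by move=> [fV fE]; split; apply: bij_inj. Qed.

Lemma isomorphic_sym G H : isomorphic G H -> isomorphic H G.
Proof.
move=> [f fB]; have [[f' _ fK] [e' _ eK]] := fB.
(* The identity of [H] and [f] are injective with the same full image, so one factors through the
   other by a bijection. *)
have [||||h [hB _]] := @hom_factor_bij H H G (hom_id H) f; last by exists h.
- by split=> x y.
- exact: bij_hom_inj.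
- by move=> v; split=> _; [exists (f' v)|exists v].
- by move=> v; split=> _; [exists (e' v)|exists v].
Qed.

Lemma bij_hom_comp G H X (g : hom H X) (f : hom G H) :
  bij_hom g -> bij_hom f -> bij_hom (hom_comp g f).
Proof. by move=> [gV gE] [fV fE]; split; apply: bij_comp. Qed.

Lemma inj_hom_comp G H X (g : hom H X) (f : hom G H) :
  inj_hom g -> inj_hom f -> inj_hom (hom_comp g f).
Proof. by move=> [gV gE] [fV fE]; split; apply: inj_comp. Qed.

(* Elementwise description of the pushouts in which all four maps are injective. *)
Definition gpo K L D G (b : hom K L) (d : hom K D) (g : hom L G) (i : hom D G) :=
  fpo (homV b) (homV d) (homV g) (homV i) /\ fpo (homE b) (homE d) (homE g) (homE i).

Lemma gpo_univ K L D G Z (b : hom K L) (d : hom K D) (g : hom L G) (i : hom D G)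
    (p : hom L Z) (q : hom D Z) :
  gpo b d g i -> hom_comp p b = hom_comp q d ->
  exists u : hom G Z, hom_comp u g = p /\ hom_comp u i = q.
Proof.
move=> [poV poE] pq.
have pqV k : homV p (homV b k) = homV q (homV d k).
  by have := congr1 (fun h => homV h k) pq.
have pqE k : homE p (homE b k) = homE q (homE d k).
  by have := congr1 (fun h => homE h k) pq.
have [uV [uVg uVi]] := fpo_univ poV pqV.
have [uE [uEg uEi]] := fpo_univ poE pqE.
have us e : src (uE e) = uV (src e).
  by move: e; apply: (fpo_ind poE) => x; rewrite ?uEg ?uEi !hom_src ?uVg ?uVi.
have ut e : tgt (uE e) = uV (tgt e).
  by move: e; apply: (fpo_ind poE) => x; rewrite ?uEg ?uEi !hom_tgt ?uVg ?uVi.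
have un v : nlab (uV v) = nlab v.
  by move: v; apply: (fpo_ind poV) => x; rewrite ?uVg ?uVi !hom_nlab.
have ue e : elab (uE e) = elab e.
  by move: e; apply: (fpo_ind poE) => x; rewrite ?uEg ?uEi !hom_elab.
by exists (Hom us ut un ue); split; apply: hom_ext.
Qed.

Lemma gpo_comm K L D G (b : hom K L) (d : hom K D) (g : hom L G) (i : hom D G) :
  gpo b d g i -> hom_comp g b = hom_comp i d.
Proof. by move=> [[cV _ _ _ _] [cE _ _ _ _]]; apply: hom_ext. Qed.

Lemma gpo_hom_eq K L D G Z (b : hom K L) (d : hom K D) (g : hom L G) (i : hom D G)
    (u v : hom G Z) :
  gpo b d g i -> hom_comp u g = hom_comp v g -> hom_comp u i = hom_comp v i -> u = v.
Proof.
move=> [poV poE] eg ei; apply: hom_ext.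
- apply: (fpo_ind poV) => x.
  + exact: (congr1 (fun h => homV h x) eg).
  + exact: (congr1 (fun h => homV h x) ei).
- apply: (fpo_ind poE) => x.
  + exact: (congr1 (fun h => homE h x) eg).
  + exact: (congr1 (fun h => homE h x) ei).
Qed.

Lemma gpo_pushout K L D G (b : hom K L) (d : hom K D) (g : hom L G) (i : hom D G) :
  gpo b d g i -> is_pushout b d g i.
Proof.
move=> po; split; first exact: gpo_comm.
move=> Z p q /(gpo_univ po) [u [ug ui]]; exists u; split=> // v [vg vi].
by apply: (gpo_hom_eq po); rewrite ?ug ?ui.
Qed.

(** Nodes and edges are glued separately; sources, targets and labels of the result are themselves
    mediating maps out of these two pushouts of sets. *)
Lemma gpo_exists K L D (b : hom K L) (d : hom K D) :
  inj_hom b -> inj_hom d -> exists G (g : hom L G) (i : hom D G), gpo b d g i.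
Proof.
move=> [bV bE] [dV dE].
have [V [gV [iV poV]]] := fpo_exists bV dV.
have [E [gE [iE poE]]] := fpo_exists bE dE.
have [comm _ _ _ _] := poV.
have [s [sg si]] : exists s : E -> V,
    (forall x, s (gE x) = gV (src x)) /\ (forall y, s (iE y) = iV (src y)).
  by apply: (fpo_univ poE) => k; rewrite !hom_src.
have [t [tg ti]] : exists t : E -> V,
    (forall x, t (gE x) = gV (tgt x)) /\ (forall y, t (iE y) = iV (tgt y)).
  by apply: (fpo_univ poE) => k; rewrite !hom_tgt.
have [n [ng ni]] : exists n : V -> node_label S,
    (forall x, n (gV x) = nlab x) /\ (forall y, n (iV y) = nlab y).
  by apply: (fpo_univ poV) => k; rewrite !hom_nlab.
have [l [lg li]] : exists l : E -> edge_label S,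
    (forall x, l (gE x) = elab x) /\ (forall y, l (iE y) = elab y).
  by apply: (fpo_univ poE) => k; rewrite !hom_elab.
exists (Graph s t n l).
by exists (@Hom _ L (Graph s t n l) gV gE sg tg ng lg),
  (@Hom _ D (Graph s t n l) iV iE si ti ni li).
Qed.

Lemma gpo_comp_bij K L D G H (b : hom K L) (d : hom K D) (g : hom L G) (i : hom D G)
    (f : hom G H) :
  bij_hom f -> gpo b d g i -> gpo b d (hom_comp f g) (hom_comp f i).
Proof. by move=> [fV fE] [poV poE]; split; apply: fpo_comp_bij. Qed.

(** The given pushout is compared with the one constructed elementwise: the mediating morphisms are
    mutually inverse, and the elementwise description moves along this isomorphism. *)
Lemma pushout_gpo K L D G (b : hom K L) (d : hom K D) (g : hom L G) (i : hom D G) :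
  inj_hom b -> inj_hom d -> is_pushout b d g i -> gpo b d g i.
Proof.
move=> bI dI [comm univ]; have [P [gP [iP po]]] := gpo_exists bI dI.
have [u [[ug ui] _]] := univ _ _ _ (gpo_comm po).
have [u' [u'g u'i]] := gpo_univ po comm.
have compA : hom_comp u' u = hom_id G.
  have [w [_ wU]] := univ _ _ _ comm.
  have <- : w = hom_id G by apply: wU; split; apply: hom_ext.
  apply/esym/wU; split.
  - by rewrite -[RHS]u'g -ug; apply: hom_ext.
  - by rewrite -[RHS]u'i -ui; apply: hom_ext.
have compB : hom_comp u u' = hom_id P.
  apply: (gpo_hom_eq po).
  - by transitivity gP; [rewrite -[RHS]ug -u'g|]; apply: hom_ext.
  - by transitivity iP; [rewrite -[RHS]ui -u'i|]; apply: hom_ext.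
rewrite -u'g -u'i; apply: gpo_comp_bij => //; split.
- exists (homV u) => x.
  + exact: (congr1 (fun h => homV h x) compB).
  + exact: (congr1 (fun h => homV h x) compA).
- exists (homE u) => x.
  + exact: (congr1 (fun h => homE h x) compB).
  + exact: (congr1 (fun h => homE h x) compA).
Qed.

Lemma gpo_inj K L D G (b : hom K L) (d : hom K D) (g : hom L G) (i : hom D G) :
  gpo b d g i -> inj_hom g /\ inj_hom i.
Proof. by move=> [[_ ? ? _ _] [_ ? ? _ _]]. Qed.

Definition sub_incl G (A : subgraph G) : hom (graph_of_subgraph A) G.
Proof. by exists val val. Defined.

Lemma sub_incl_inj G (A : subgraph G) : inj_hom (sub_incl A).
Proof. by split; apply: val_inj. Qed.

(** * Direct derivations: dangling condition, existence, uniqueness, tracks *)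

Section Derivations.
Variable r : rule S.

(** The context map is injective because followed by [dd_in d] it equals the injective match of the
    interface. Hence both squares are pushouts along injections. *)
Lemma dd_gpo G H (d : dderivation r G H) :
  gpo (incl_l r) (dd_ctx_map d) (dd_match d) (dd_in d) /\
  gpo (incl_r r) (dd_ctx_map d) (dd_comatch d) (dd_in' d).
Proof.
suff cI : inj_hom (dd_ctx_map d).
  split; apply: pushout_gpo => //; [|exact: dd_po_l| |exact: dd_po_r].
  - exact: incl_l_inj.
  - exact: incl_r_inj.
have [mV mE] := inj_hom_comp (dd_match_inj d) (incl_l_inj r).
have [comm _] := dd_po_l d; rewrite comm in mV mE.
by split=> x y e; [apply: mV|apply: mE]; rewrite /= e.
Qed.

Lemma gpo_dd G H D (c : hom (interface r) D) (m : hom (lhs r) G) (i : hom D G)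
    (m' : hom (rhs r) H) (i' : hom D H) :
  gpo (incl_l r) c m i -> gpo (incl_r r) c m' i' ->
  exists d : dderivation r G H, dd_match d = m.
Proof.
move=> pol por; have [mI _] := gpo_inj pol.
by exists (DDerivation mI (gpo_pushout pol) (gpo_pushout por)).
Qed.

Definition dangling_condition G (g : hom (lhs r) G) : Prop :=
  forall e, (forall x, homE g x <> e) ->
  forall x, homV g x = src e \/ homV g x = tgt e ->
  exists k, homV (incl_l r) k = x.

(** An edge outside the match lies in the context, and so do its endpoints; a matched node lying in
    the context comes from the interface. *)
Lemma dd_dangling G H (d : dderivation r G H) : dangling_condition (dd_match d).
Proof.
have [[[_ _ _ _ capV] [_ _ _ covE _]] _] := dd_gpo d.
move=> e eN x; case: (covE e) => [[y /eN //]|[y <-]].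
by rewrite hom_src hom_tgt => -[/capV|/capV] [k [kE _]]; exists k.
Qed.

(** The context is [G] without the deleted items. It is closed under endpoints: a matched edge that
    survives comes from an interface edge, and for an unmatched edge the dangling condition
    applies. *)
Lemma dd_exists G (g : hom (lhs r) G) :
  inj_hom g -> dangling_condition g ->
  exists H (d : dderivation r G H), dd_match d = g.
Proof.
move=> [gV gE] dang.
(* An item is kept when all its preimages under the match lie in the interface; unmatched items are
   kept vacuously. *)
pose kV := [set v | [forall x, (homV g x == v) ==> (x \in codom (homV (incl_l r)))]].
pose kE := [set e | [forall x, (homE g x == e) ==> (x \in codom (homE (incl_l r)))]].
have kVP v : reflect (forall x, homV g x = v -> exists k, homV (incl_l r) k = x) (v \in kV).
  rewrite inE; apply: (iffP forallP) => h x.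
  - by move=> /eqP xv; have /implyP /(_ xv) /codomP [k ->] := h x; exists k.
  - by apply/implyP => /eqP /h [k <-]; apply: codom_f.
have kEP v : reflect (forall x, homE g x = v -> exists k, homE (incl_l r) k = x) (v \in kE).
  rewrite inE; apply: (iffP forallP) => h x.
  - by move=> /eqP xv; have /implyP /(_ xv) /codomP [k ->] := h x; exists k.
  - by apply/implyP => /eqP /h [k <-]; apply: codom_f.
have ks e : e \in kE -> src e \in kV.
  move=> /kEP eK; apply/kVP => x xE.
  case: (classic (exists y, homE g y = e)) => [[y yE]|eN].
  - have [k kE'] := eK _ yE; exists (src k).
    by apply: gV; rewrite xE -yE -kE' !hom_src.
  - by apply: (dang e) => [y yE|]; [apply: eN; exists y|left].
have kt e : e \in kE -> tgt e \in kV.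
  move=> /kEP eK; apply/kVP => x xE.
  case: (classic (exists y, homE g y = e)) => [[y yE]|eN].
  - have [k kE'] := eK _ yE; exists (tgt k).
    by apply: gV; rewrite xE -yE -kE' !hom_tgt.
  - by apply: (dang e) => [y yE|]; [apply: eN; exists y|right].
pose A := Subgraph ks kt; have [bV bE] := incl_l_inj r.
have kbV k : homV g (homV (incl_l r) k) \in kV by apply/kVP => x /gV ->; exists k.
have kbE k : homE g (homE (incl_l r) k) \in kE by apply/kEP => x /gE ->; exists k.
have [c [cV cE]] : exists c : hom (interface r) (graph_of_subgraph A),
    (forall v, homV (sub_incl A) (homV c v) = homV (hom_comp g (incl_l r)) v) /\
    (forall e, homE (sub_incl A) (homE c e) = homE (hom_comp g (incl_l r)) e).
  apply: hom_factor; first exact: sub_incl_inj.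
  - by move=> v; exists (exist (fun x => x \in kV) _ (kbV v)).
  - by move=> e; exists (exist (fun x => x \in kE) _ (kbE e)).
have pol : gpo (incl_l r) c g (sub_incl A).
  split; split=> //; try exact: val_inj.
  - move=> v; case: (classic (exists x, homV g x = v)); [by left|right].
    suff vK : v \in kV by exists (exist (fun x => x \in kV) v vK).
    by apply/kVP => x xE; case: b; exists x.
  - move=> x y xy; have /kVP /(_ x xy) [k kE'] := valP y; exists k; split=> //.
    by apply: val_inj; rewrite -[RHS]xy -kE'; apply: cV.
  - move=> v; case: (classic (exists x, homE g x = v)); [by left|right].
    suff vK : v \in kE by exists (exist (fun x => x \in kE) v vK).
    by apply/kEP => x xE; case: b; exists x.
  - move=> x y xy; have /kEP /(_ x xy) [k kE'] := valP y; exists k; split=> //.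
    by apply: val_inj; rewrite -[RHS]xy -kE'; apply: cE.
have cI : inj_hom c.
  split=> x y xy; [apply/bV/gV|apply/bE/gE].
  - exact: etrans (esym (cV x)) (etrans (congr1 (homV (sub_incl A)) xy) (cV y)).
  - exact: etrans (esym (cE x)) (etrans (congr1 (homE (sub_incl A)) xy) (cE y)).
have [H [m' [i' por]]] := gpo_exists (incl_r_inj r) cI.
by exists H; apply: gpo_dd pol por.
Qed.

Lemma dd_bij_l G X H (f : hom X G) (d : dderivation r X H) :
  bij_hom f ->
  exists d' : dderivation r G H, dd_match d' = hom_comp f (dd_match d).
Proof.
move=> fB; have [pol por] := dd_gpo d.
exact: gpo_dd (gpo_comp_bij fB pol) por.
Qed.

(** What survives depends on the match alone. One inclusion suffices, as the situation is symmetric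
    in [d] and [d']. *)
Lemma dd_in_image G H H' (d : dderivation r G H) (d' : dderivation r G H') :
  dd_match d = dd_match d' ->
  (forall v, (exists y, homV (dd_in d) y = v) -> (exists y, homV (dd_in d') y = v)) /\
  (forall e, (exists y, homE (dd_in d) y = e) -> (exists y, homE (dd_in d') y = e)).
Proof.
move=> mE.
have [[[cmV _ _ _ capV] [cmE _ _ _ capE]] _] := dd_gpo d.
have [[[cmV' _ _ covV' _] [cmE' _ _ covE' _]] _] := dd_gpo d'.
split=> v [y <-].
- case: (covV' (homV (dd_in d) y)) => [[x]|//]; rewrite -mE => /capV [k [_ <-]].
  by exists (homV (dd_ctx_map d') k); rewrite -cmV' -cmV mE.
- case: (covE' (homE (dd_in d) y)) => [[x]|//]; rewrite -mE => /capE [k [_ <-]].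
  by exists (homE (dd_ctx_map d') k); rewrite -cmE' -cmE mE.
Qed.

(** The two contexts have the same image in [G], hence are isomorphic compatibly with the interface.
    Both results are then pushouts of one span. *)
Lemma dd_unique G H H' (d : dderivation r G H) (d' : dderivation r G H') :
  dd_match d = dd_match d' -> isomorphic H H'.
Proof.
move=> mE; have [pol [porV porE]] := dd_gpo d; have [pol' [porV' porE']] := dd_gpo d'.
have [_ iI'] := gpo_inj pol'; have [_ iI] := gpo_inj pol.
have [imV imE] := dd_in_image mE; have [imV' imE'] := dd_in_image (esym mE).
have [||h [[hV hE] hi]] := hom_factor_bij iI iI'.
- by move=> v; split; [apply: imV|apply: imV'].
- by move=> e; split; [apply: imE|apply: imE'].
have hc : hom_comp h (dd_ctx_map d) = dd_ctx_map d'.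
  have eq : hom_comp (dd_in d') (hom_comp h (dd_ctx_map d)) =
            hom_comp (dd_in d') (dd_ctx_map d').
    rewrite -(gpo_comm pol') -mE (gpo_comm pol) -hi; exact: hom_ext.
  apply: hom_ext => x.
  - by case: iI' => I _; apply: I; apply: (congr1 (fun f => homV f x) eq).
  - by case: iI' => _ I; apply: I; apply: (congr1 (fun f => homE f x) eq).
have po2 : gpo (incl_r r) (dd_ctx_map d) (dd_comatch d') (hom_comp (dd_in' d') h).
  split; [apply: fpo_ctx_bij hV _ porV'|apply: fpo_ctx_bij hE _ porE'] => k;
    by rewrite -hc.
have [u [um ui]] := gpo_univ (conj porV porE) (gpo_comm po2).
exists u; split.
- apply: fpo_bij porV (proj1 po2) _ _ => x.
  + by rewrite -um.
  + by rewrite -ui.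
- apply: fpo_bij porE (proj2 po2) _ _ => x.
  + by rewrite -um.
  + by rewrite -ui.
Qed.

Lemma dd_track_defined G H (d : dderivation r G H) v :
  (forall x, homV (dd_match d) x = v -> exists k, homV (incl_l r) k = x) ->
  dd_track d v != None.
Proof.
move=> vK; rewrite /dd_track; case: pickP => //= no.
have [[[comm _ _ cov _] _] _] := dd_gpo d.
case: (cov v) => [[x xE]|[y yE]]; last by have := no y; rewrite yE eqxx.
have [k kx] := vK _ xE; have := no (homV (dd_ctx_map d) k).
by rewrite -comm kx xE eqxx.
Qed.

Lemma dd_track_Some G H (d : dderivation r G H) v w :
  dd_track d v = Some w ->
  exists y, homV (dd_in d) y = v /\ homV (dd_in' d) y = w.
Proof.
by rewrite /dd_track; case: pickP => //= y /eqP yE [<-]; exists y.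
Qed.

End Derivations.
Lemma gpo_sym K L D G (b : hom K L) (d : hom K D) (g : hom L G) (i : hom D G) :
  gpo b d g i -> gpo d b i g.
Proof. by move=> [poV poE]; split; apply: fpo_sym. Qed.

(** * The local Church-Rosser property *)

Section ParallelIndependence.
Variables (r1 r2 : rule S) (G H1 H2 : graph S).
Variables (d1 : dderivation r1 G H1) (d2 : dderivation r2 G H2).

Lemma parallelly_independent_sym :
  parallelly_independent d1 d2 -> parallelly_independent d2 d1.
Proof.
by move=> [pV pE]; split=> z z2 z1; [have [] := pV z z1 z2|have [] := pE z z1 z2].
Qed.

(** The categorical form of independence: the second match avoids all that the first step deletes,
    so it lands in the first context. *)
Lemma parallelly_independent_factor :
  parallelly_independent d1 d2 ->
  exists h : hom (lhs r2) (dd_ctx d1), hom_comp (dd_in d1) h = dd_match d2.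
Proof.
move=> [pV pE]; have [[poV poE] _] := dd_gpo d1.
have [_ iI] := gpo_inj (conj poV poE).
have [||h [hV hE]] := hom_factor (f := dd_match d2) iI; last first.
  by exists h; apply: hom_ext.
- move=> x; have [comm _ _ cov _] := poE.
  case: (cov (homE (dd_match d2) x)) => [e1|//].
  have [|[k <-] _] := pE _ e1; first by exists x.
  by exists (homE (dd_ctx_map d1) k).
- move=> x; have [comm _ _ cov _] := poV.
  case: (cov (homV (dd_match d2) x)) => [e1|//].
  have [|[k <-] _] := pV _ e1; first by exists x.
  by exists (homV (dd_ctx_map d1) k).
Qed.

(* [D] is the intersection of the two contexts and [E1], [E2] are the results of
   gluing in one right-hand side; then [H1] is [E1] glued with [lhs r2]. *)
Lemma residual_step D E1 E2 M (j1 : hom D (dd_ctx d1))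
    (k1 : hom (interface r1) D) (k2 : hom (interface r2) D)
    (h2 : hom (lhs r2) (dd_ctx d1))
    (p1 : hom (rhs r1) E1) (q1 : hom D E1) (p2 : hom (rhs r2) E2) (q2 : hom D E2)
    (n1 : hom E1 M) (n2 : hom E2 M) :
  gpo (incl_l r2) k2 h2 j1 -> hom_comp j1 k1 = dd_ctx_map d1 ->
  gpo (incl_r r1) k1 p1 q1 -> gpo (incl_r r2) k2 p2 q2 -> gpo q2 q1 n2 n1 ->
  inhabited (dderivation r2 H1 M).
Proof.
move=> poD jk po1 po2 poM; have [_ por] := dd_gpo d1; rewrite -jk in por.
have [|u [um ui]] := gpo_univ po1 (Z := H1) (p := dd_comatch d1)
  (q := hom_comp (dd_in' d1) j1).
  by rewrite (gpo_comm por); apply: hom_ext.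
have [_ [jV jE]] := gpo_inj poD.
(* Decomposing the right pushout of [d1] shows that [H1] is its context glued with [E1] along
   [D]. *)
have poH : gpo j1 q1 (dd_in' d1) u.
  have [po1V po1E] := po1; have [porV porE] := por.
  split; [apply: (fpo_cancel jV po1V porV)|apply: (fpo_cancel jE po1E porE)] => x.
  - by rewrite -um.
  - exact: (congr1 (fun f => homV f x) ui).
  - by rewrite -um.
  - exact: (congr1 (fun f => homE f x) ui).
(* [E1] is the context of the residual step; its two squares arise by pasting. *)
have pol' : gpo (incl_l r2) (hom_comp q1 k2) (hom_comp (dd_in' d1) h2) u.
  exact: conj (fpo_paste (proj1 poD) (proj1 poH)) (fpo_paste (proj2 poD) (proj2 poH)).
have por' : gpo (incl_r r2) (hom_comp q1 k2) (hom_comp n2 p2) n1.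
  exact: conj (fpo_paste (proj1 po2) (proj1 poM)) (fpo_paste (proj2 po2) (proj2 poM)).
by have [d _] := gpo_dd pol' por'.
Qed.

End ParallelIndependence.

(** The common reduct [M] glues both right-hand sides to the intersection [D] of the contexts. The
    construction is symmetric, so [residual_step] supplies both steps. *)
Lemma church_rosser r1 r2 G H1 H2 (d1 : dderivation r1 G H1) (d2 : dderivation r2 G H2) :
  parallelly_independent d1 d2 ->
  exists M, inhabited (dderivation r2 H1 M) /\ inhabited (dderivation r1 H2 M).
Proof.
move=> ind; have [h2 h2E] := parallelly_independent_factor ind.
have [h1 h1E] := parallelly_independent_factor (parallelly_independent_sym ind).
have [pol1 _] := dd_gpo d1; have [pol2 _] := dd_gpo d2.
have [_ i1I] := gpo_inj pol1; have [_ i2I] := gpo_inj pol2.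
pose V := [set v in codom (homV (dd_in d1)) | v \in codom (homV (dd_in d2))].
pose E := [set e in codom (homE (dd_in d1)) | e \in codom (homE (dd_in d2))].
have VP y1 y2 : homV (dd_in d1) y1 = homV (dd_in d2) y2 -> homV (dd_in d2) y2 \in V.
  by move=> yE; rewrite inE -{1}yE !codom_f.
have EP y1 y2 : homE (dd_in d1) y1 = homE (dd_in d2) y2 -> homE (dd_in d2) y2 \in E.
  by move=> yE; rewrite inE -{1}yE !codom_f.
have sE e : e \in E -> src e \in V.
  rewrite inE => /andP [/codomP [y1 ->] /codomP [y2 e2]].
  by rewrite e2 hom_src; apply: (VP (src y1)); rewrite -!hom_src e2.
have tE e : e \in E -> tgt e \in V.
  rewrite inE => /andP [/codomP [y1 ->] /codomP [y2 e2]].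
  by rewrite e2 hom_tgt; apply: (VP (tgt y1)); rewrite -!hom_tgt e2.
pose A := Subgraph sE tE; pose D := graph_of_subgraph A.
have [aV aE] := sub_incl_inj A.
have [||j1 [j1V j1E]] := hom_factor (f := sub_incl A) i1I.
- by move=> [v vV] /=; move: vV; rewrite inE => /andP [/codomP [y ->] _]; exists y.
- by move=> [e eE] /=; move: eE; rewrite inE => /andP [/codomP [y ->] _]; exists y.
have [||j2 [j2V j2E]] := hom_factor (f := sub_incl A) i2I.
- by move=> [v vV] /=; move: vV; rewrite inE => /andP [_ /codomP [y ->]]; exists y.
- by move=> [e eE] /=; move: eE; rewrite inE => /andP [_ /codomP [y ->]]; exists y.
have h1V x : homV (dd_in d2) (homV h1 x) = homV (dd_match d1) x by rewrite -h1E.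
have h1E' x : homE (dd_in d2) (homE h1 x) = homE (dd_match d1) x by rewrite -h1E.
have h2V x : homV (dd_in d1) (homV h2 x) = homV (dd_match d2) x by rewrite -h2E.
have h2E' x : homE (dd_in d1) (homE h2 x) = homE (dd_match d2) x by rewrite -h2E.
have [[c1V _ _ _ _] [c1E _ _ _ _]] := pol1; have [[c2V _ _ _ _] [c2E _ _ _ _]] := pol2.
have subV y1 y2 : homV (dd_in d1) y1 = homV (dd_in d2) y2 ->
    exists z : node D, homV (sub_incl A) z = homV (dd_in d2) y2.
  by move/VP => yV; exists (exist (fun x => x \in V) _ yV).
have subE y1 y2 : homE (dd_in d1) y1 = homE (dd_in d2) y2 ->
    exists z : edge D, homE (sub_incl A) z = homE (dd_in d2) y2.
  by move/EP => yE; exists (exist (fun x => x \in E) _ yE).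
have [||k1 [k1V k1E]] := hom_factor (f := hom_comp (dd_match d1) (incl_l r1)) (sub_incl_inj A).
- by move=> x /=; rewrite -h1V; apply: (subV (homV (dd_ctx_map d1) x)); rewrite h1V c1V.
- by move=> x /=; rewrite -h1E'; apply: (subE (homE (dd_ctx_map d1) x)); rewrite h1E' c1E.
have [||k2 [k2V k2E]] := hom_factor (f := hom_comp (dd_match d2) (incl_l r2)) (sub_incl_inj A).
- by move=> x /=; rewrite c2V; apply: (subV (homV h2 (homV (incl_l r2) x))); rewrite h2V c2V.
- by move=> x /=; rewrite c2E; apply: (subE (homE h2 (homE (incl_l r2) x))); rewrite h2E' c2E.
have jk1 : hom_comp j1 k1 = dd_ctx_map d1.
  apply: hom_ext => x /=; [apply: (proj1 i1I)|apply: (proj2 i1I)].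
  - by rewrite j1V k1V /= c1V.
  - by rewrite j1E k1E /= c1E.
have jk2 : hom_comp j2 k2 = dd_ctx_map d2.
  apply: hom_ext => x /=; [apply: (proj1 i2I)|apply: (proj2 i2I)].
  - by rewrite j2V k2V /= c2V.
  - by rewrite j2E k2E /= c2E.
have j1I : inj_hom j1.
  split=> x y xy; [apply: aV|apply: aE].
  - by rewrite -[LHS]j1V -[RHS]j1V xy.
  - by rewrite -[LHS]j1E -[RHS]j1E xy.
have j2I : inj_hom j2.
  split=> x y xy; [apply: aV|apply: aE].
  - by rewrite -[LHS]j2V -[RHS]j2V xy.
  - by rewrite -[LHS]j2E -[RHS]j2E xy.
(* The left square of [d1] is restricted to the context of [d2], which contains the whole first
   match. *)
have poD2 : gpo (incl_l r1) k1 h1 j2.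
  split.
  - apply: (fpo_pullback (proj1 i2I) (proj1 j1I) (proj1 j2I) (proj1 pol1)) => //.
    + by move=> z; rewrite j1V j2V.
    + by move=> x y /subV [z zE]; exists z; apply: (proj1 i2I); rewrite j2V.
    + by move=> x; rewrite -jk1.
  - apply: (fpo_pullback (proj2 i2I) (proj2 j1I) (proj2 j2I) (proj2 pol1)) => //.
    + by move=> z; rewrite j1E j2E.
    + by move=> x y /subE [z zE]; exists z; apply: (proj2 i2I); rewrite j2E.
    + by move=> x; rewrite -jk1.
have poD1 : gpo (incl_l r2) k2 h2 j1.
  split.
  - apply: (fpo_pullback (proj1 i1I) (proj1 j2I) (proj1 j1I) (proj1 pol2)) => //.
    + by move=> z; rewrite j1V j2V.
    + move=> x y xy; have [z zE] := subV _ _ (esym xy).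
      by exists z; apply: (proj1 i1I); rewrite j1V -xy.
    + by move=> x; rewrite -jk2.
  - apply: (fpo_pullback (proj2 i1I) (proj2 j2I) (proj2 j1I) (proj2 pol2)) => //.
    + by move=> z; rewrite j1E j2E.
    + move=> x y xy; have [z zE] := subE _ _ (esym xy).
      by exists z; apply: (proj2 i1I); rewrite j1E -xy.
    + by move=> x; rewrite -jk2.
have k1I : inj_hom k1.
  have [m1V m1E] := inj_hom_comp (dd_match_inj d1) (incl_l_inj r1).
  by split=> x y xy; [apply: m1V; rewrite -!k1V xy|apply: m1E; rewrite -!k1E xy].
have k2I : inj_hom k2.
  have [m2V m2E] := inj_hom_comp (dd_match_inj d2) (incl_l_inj r2).
  by split=> x y xy; [apply: m2V; rewrite -!k2V xy|apply: m2E; rewrite -!k2E xy].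
have [E1 [p1 [q1 po1]]] := gpo_exists (incl_r_inj r1) k1I.
have [E2 [p2 [q2 po2]]] := gpo_exists (incl_r_inj r2) k2I.
have [_ q1I] := gpo_inj po1; have [_ q2I] := gpo_inj po2.
have [M [n2 [n1 poM]]] := gpo_exists q2I q1I.
exists M; split.
- exact: residual_step poD1 jk1 po1 po2 poM.
- exact: residual_step poD2 jk2 po2 po1 (gpo_sym poM).
Qed.

(* A context is glued to a graph [X] along a map [bnd C -> node X], which need
   not be injective. *)
Record context := Context {
  bnd : finType;
  cnode : finType;
  cedge : finType;
  csrc : cedge -> bnd + cnode;
  ctgt : cedge -> bnd + cnode;
  cnlab : cnode -> node_label S;
  celab : cedge -> edge_label S
}.

(** * Gluing a context to a graph and to a direct derivation *)

Section Extension.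
Variable C : context.

Definition ext X (a : bnd C -> node X) : graph S :=
  @Graph S (node X + cnode C)%type (edge X + cedge C)%type
    (fun e => match e with inl e => inl (src e) | inr e => sum_map a (csrc e) end)
    (fun e => match e with inl e => inl (tgt e) | inr e => sum_map a (ctgt e) end)
    (fun v => match v with inl v => nlab v | inr v => cnlab v end)
    (fun e => match e with inl e => elab e | inr e => celab e end).

Definition ext_inl X (a : bnd C -> node X) : hom X (ext a).
Proof. by exists inl inl. Defined.

Definition ext_hom X Y (f : hom X Y) (a : bnd C -> node X) (a' : bnd C -> node Y)
  (fa : forall w, homV f (a w) = a' w) : hom (ext a) (ext a').
Proof.
exists (sum_map (homV f)) (sum_map (homE f)).
- by move=> [e|e] /=; [rewrite hom_src|case: (csrc e) => //= w; rewrite fa].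
- by move=> [e|e] /=; [rewrite hom_tgt|case: (ctgt e) => //= w; rewrite fa].
- by move=> [v|v] //=; rewrite hom_nlab.
- by move=> [e|e] //=; rewrite hom_elab.
Defined.

Lemma ext_iso X Y (f : hom X Y) (a : bnd C -> node X) (a' : bnd C -> node Y) :
  bij_hom f -> (forall w, homV f (a w) = a' w) -> isomorphic (ext a) (ext a').
Proof.
by move=> [fV fE] fa; exists (ext_hom fa); split; apply: sum_map_bij.
Qed.

(** A defined track means that each gluing point has a preimage in the context of [d]. Gluing [C]
    there extends both pushout squares. *)
Lemma ext_dd r X Y (d : dderivation r X Y) (a : bnd C -> node X) (a' : bnd C -> node Y) :
  (forall w, dd_track d (a w) = Some (a' w)) ->
  exists d' : dderivation r (ext a) (ext a'),
    dd_match d' = hom_comp (ext_inl a) (dd_match d).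
Proof.
move=> tr; have /fin_all_exists [c cP] := fun w => dd_track_Some (tr w).
have [[polV polE] [porV porE]] := dd_gpo d.
have pol : gpo (incl_l r) (hom_comp (ext_inl c) (dd_ctx_map d))
    (hom_comp (ext_inl a) (dd_match d)) (ext_hom (fun w => proj1 (cP w))).
  by split; apply: fpo_sum.
have por : gpo (incl_r r) (hom_comp (ext_inl c) (dd_ctx_map d))
    (hom_comp (ext_inl a') (dd_comatch d)) (ext_hom (fun w => proj2 (cP w))).
  by split; apply: fpo_sum.
exact: gpo_dd pol por.
Qed.

End Extension.
End Graphs.

(** * Derivations of a system: change of start graph and extension *)

Section Systems.
Variable T : gt_system.
Implicit Types G H X Y : graph T.

(** The isomorphism is absorbed into the match of the first step. *)
Lemma steps_iso_l G X Y : isomorphic G X -> steps X Y -> inhabited (steps G Y).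
Proof.
move=> /isomorphic_sym [f fB]; elim=> [Z s|Z W _ [ih] s].
- by have [d _] := dd_bij_l (step_dd s) fB; constructor; apply/Steps1/(Step (step_mem s) d).
- by constructor; apply: StepsS ih s.
Qed.

Lemma derives_iso_l G X Y : isomorphic G X -> derives X Y -> derives G Y.
Proof.
move=> GX [[f fB|s]].
- by have [g gB] := GX; constructor; apply: DerivIso (bij_hom_comp fB gB).
- by have [s'] := steps_iso_l GX s; constructor; apply: DerivSteps.
Qed.

Lemma ext_steps (C : context T) X Y (s : steps X Y) (a : bnd C -> node X) (a' : bnd C -> node Y) :
  (forall w, steps_track s (a w) = Some (a' w)) -> inhabited (steps (ext a) (ext a')).
Proof.
elim: s a' => [Z s|Z W s ih t] a' /= tr.
- by have [d _] := ext_dd tr; constructor; apply/Steps1/(Step (step_mem s) d).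
(* Since the composed track is defined, each gluing point has a position [c] in the intermediate
   graph. *)
- have /fin_all_exists [c cP] : forall w, exists z, steps_track s (a w) = Some z /\
      dd_track (step_dd t) z = Some (a' w).
    by move=> w; have := tr w; case: (steps_track s (a w)) => //= z zE; exists z.
  have [s'] := ih c (fun w => proj1 (cP w)).
  have [d _] := ext_dd (fun w => proj2 (cP w)).
  by constructor; apply: StepsS s' (Step (step_mem t) d).
Qed.

Lemma ext_derives (C : context T) X Y (e : derivation X Y)
    (a : bnd C -> node X) (a' : bnd C -> node Y) :
  (forall w, deriv_track e (a w) = Some (a' w)) -> derives (ext a) (ext a').
Proof.
case: e => [f fB|s] /= tr.
- have [|f' f'B] := @ext_iso _ C _ _ f a a' fB; first by move=> w; case: (tr w).
  by constructor; apply: DerivIso f'B.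
- by have [s'] := ext_steps tr; constructor; apply: DerivSteps.
Qed.

End Systems.

(** * Restricting a step to a subgraph that contains its match *)

Section Restriction.
Variables (S : signature) (r : rule S) (G H : graph S) (d : dderivation r G H).
Variable A : subgraph G.

(** The dangling condition is inherited because the subgraph has no edges beyond those of [G]. *)
Lemma dd_restrict :
  (forall x, homV (dd_match d) x \in sub_node A) ->
  (forall x, homE (dd_match d) x \in sub_edge A) ->
  exists H' (d' : dderivation r (graph_of_subgraph A) H'),
    hom_comp (sub_incl A) (dd_match d') = dd_match d.
Proof.
move=> mA mAE.
have [||m [mV mE]] := hom_factor (f := dd_match d) (sub_incl_inj A).
- by move=> x; exists (exist (fun v => v \in sub_node A) _ (mA x)).
- by move=> x; exists (exist (fun v => v \in sub_edge A) _ (mAE x)).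
have [dV dE] := dd_match_inj d.
have mI : inj_hom m.
  by split=> x y xy; [apply: dV; rewrite -!mV xy|apply: dE; rewrite -!mE xy].
have mD : dangling_condition m.
  move=> e eN x xe; apply: (@dd_dangling _ _ _ _ d (val e)).
  - by move=> y yE; apply: (eN y); apply: val_inj; rewrite -yE -mE.
  - by rewrite -mV; case: xe => ->; [left|right].
have [H' [d' d'm]] := dd_exists mI mD.
by exists H', d'; rewrite d'm; apply: hom_ext.
Qed.

(** The edge [e] lies outside the match, so the dangling condition of the step on all of [G] keeps
    its endpoints from being deleted. *)
Lemma dd_restrict_track H' (d' : dderivation r (graph_of_subgraph A) H')
    (e : edge G) (v : node (graph_of_subgraph A)) :
  hom_comp (sub_incl A) (dd_match d') = dd_match d -> e \notin sub_edge A ->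
  val v = src e \/ val v = tgt e -> dd_track d' v != None.
Proof.
move=> d'm eA ve; apply: dd_track_defined => x xv.
apply: (@dd_dangling _ _ _ _ d e).
- by move=> y yE; case/negP: eA; rewrite -yE -d'm; apply: valP.
- by rewrite -d'm /= xv.
Qed.

End Restriction.

(* The boundary is deliberately all of [P], not only the nodes met by an outside
   edge. *)
Lemma subgraph_context (S : signature) (G : graph S) (A : subgraph G)
    (P : pred (node (graph_of_subgraph A))) :
  (forall (e : edge G) v, e \notin sub_edge A -> val v = src e \/ val v = tgt e -> P v) ->
  exists (C : context S) (a : bnd C -> node (graph_of_subgraph A))
    (f : hom (ext a) G),
    [/\ bij_hom f, forall w, P (a w) & hom_comp f (ext_inl a) = sub_incl A].
Proof.
move=> HP.
pose W : finType := {v | P v}.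
pose V : finType := {v : node G | v \notin sub_node A}.
pose E : finType := {e : edge G | e \notin sub_edge A}.
pose pos (z : W + V) : node G := match z with inl w => val (val w) | inr v => val v end.
(* An endpoint of an outside edge is either outside [A] or, by [HP], a boundary node; this supplies
   the incidence maps of the context. *)
have posP (e : E) v : v = src (val e) \/ v = tgt (val e) -> exists z, pos z = v.
  move=> ve; have [vA|vA] := boolP (v \in sub_node A).
  - have vP := HP (val e) (exist (fun v => v \in sub_node A) v vA) (valP e) ve.
    by exists (inl (exist (fun v => P v) _ vP)).
  - by exists (inr (exist (fun v => v \notin sub_node A) v vA)).
have /fin_all_exists [s sP] : forall e : E, exists z, pos z = src (val e).
  by move=> e; apply: (posP e); left.
have /fin_all_exists [t tP] : forall e : E, exists z, pos z = tgt (val e).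
  by move=> e; apply: (posP e); right.
pose C := @Context S W V E s t (fun v => nlab (val v)) (fun e => elab (val e)).
pose a (w : bnd C) : node (graph_of_subgraph A) := val w.
pose fV (z : node (ext a)) : node G := match z with inl v => val v | inr v => val v end.
pose fE (z : edge (ext a)) : edge G := match z with inl e => val e | inr e => val e end.
have fs e : src (fE e) = fV (src e) by case: e => [e|e] //=; rewrite -sP; case: (s e).
have ft e : tgt (fE e) = fV (tgt e) by case: e => [e|e] //=; rewrite -tP; case: (t e).
have fn v : nlab (fV v) = nlab v by case: v.
have fe e : elab (fE e) = elab e by case: e.
exists C, a, (Hom fs ft fn fe); split; last exact: hom_ext.
- split; apply: inj_surj_bij.
  + move=> [x|x] [y|y] //= xy; try by congr (_ _); apply: val_inj.
    * by case: x y xy => x xA [y yA] /= xy; case/negP: yA; rewrite -xy.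
    * by case: x y xy => x xA [y yA] /= xy; case/negP: xA; rewrite xy.
  + move=> v; have [vA|vA] := boolP (v \in sub_node A).
    * by exists (inl (exist (fun v => v \in sub_node A) v vA)).
    * by exists (inr (exist (fun v => v \notin sub_node A) v vA)).
  + move=> [x|x] [y|y] //= xy; try by congr (_ _); apply: val_inj.
    * by case: x y xy => x xA [y yA] /= xy; case/negP: yA; rewrite -xy.
    * by case: x y xy => x xA [y yA] /= xy; case/negP: xA; rewrite xy.
  + move=> v; have [vA|vA] := boolP (v \in sub_edge A).
    * by exists (inl (exist (fun v => v \in sub_edge A) v vA)).
    * by exists (inr (exist (fun v => v \notin sub_edge A) v vA)).
- by move=> w; apply: (valP w).
Qed.

(** * From a conflict to its critical pair and back *)

Lemma match_union_subgraph (S : signature) (L1 L2 G : graph S)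
    (g1 : hom L1 G) (g2 : hom L2 G) :
  exists A : subgraph G,
    (forall v, v \in sub_node A <-> (exists x, homV g1 x = v) \/ (exists x, homV g2 x = v)) /\
    (forall e, e \in sub_edge A <-> (exists x, homE g1 x = e) \/ (exists x, homE g2 x = e)).
Proof.
pose V := [set v | (v \in codom (homV g1)) || (v \in codom (homV g2))].
pose E := [set e | (e \in codom (homE g1)) || (e \in codom (homE g2))].
have sE e : e \in E -> src e \in V.
  by rewrite !inE => /orP [] /codomP [x ->]; rewrite hom_src codom_f ?orbT.
have tE e : e \in E -> tgt e \in V.
  by rewrite !inE => /orP [] /codomP [x ->]; rewrite hom_tgt codom_f ?orbT.
exists (Subgraph sE tE); split=> z; rewrite inE; split.
- by move=> /orP [] /codomP [x ->]; [left|right]; exists x.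
- by move=> [] [x <-]; rewrite codom_f ?orbT.
- by move=> /orP [] /codomP [x ->]; [left|right]; exists x.
- by move=> [] [x <-]; rewrite codom_f ?orbT.
Qed.

(** Injectivity of [sub_incl A] carries independence and equality of matches from the subgraph up to
    [G], where both are excluded. *)
Lemma critical_pair_restrict (S : signature) (r1 r2 : rule S) (G H1 H2 : graph S)
    (d1 : dderivation r1 G H1) (d2 : dderivation r2 G H2) (A : subgraph G)
    (K1 K2 : graph S)
    (c1 : dderivation r1 (graph_of_subgraph A) K1)
    (c2 : dderivation r2 (graph_of_subgraph A) K2) :
  (forall v, v \in sub_node A ->
     (exists x, homV (dd_match d1) x = v) \/ (exists x, homV (dd_match d2) x = v)) ->
  (forall e, e \in sub_edge A ->
     (exists x, homE (dd_match d1) x = e) \/ (exists x, homE (dd_match d2) x = e)) ->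
  hom_comp (sub_incl A) (dd_match c1) = dd_match d1 ->
  hom_comp (sub_incl A) (dd_match c2) = dd_match d2 ->
  ~ parallelly_independent d1 d2 ->
  (forall e : r1 = r2,
     eq_rect r1 (fun r => hom (lhs r) G) (dd_match d1) r2 e <> dd_match d2) ->
  critical_pair c1 c2.
Proof.
move=> AV AE c1m c2m ind neq; split.
- move=> [pV pE]; apply: ind; rewrite /parallelly_independent -c1m -c2m /=; split.
  + move=> _ [x1 <-] [x2 /val_inj e].
    have [||[k1 k1E] [k2 k2E]] := pV (homV (dd_match c1) x1); try by [exists x1|exists x2].
    by split; [exists k1; rewrite k1E|exists k2; rewrite k2E].
  + move=> _ [x1 <-] [x2 /val_inj e].
    have [||[k1 k1E] [k2 k2E]] := pE (homE (dd_match c1) x1); try by [exists x1|exists x2].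
    by split; [exists k1; rewrite k1E|exists k2; rewrite k2E].
- split=> v.
  + case: (AV (val v) (valP v)) => [] [x]; rewrite -?c1m -?c2m /= => /val_inj <-.
    * by left; exists x.
    * by right; exists x.
  + case: (AE (val v) (valP v)) => [] [x]; rewrite -?c1m -?c2m /= => /val_inj <-.
    * by left; exists x.
    * by right; exists x.
- move=> e ceq; apply: (neq e); rewrite -c1m -c2m -{}ceq.
  (* Transport along [e] commutes with composition by the inclusion, which is immediate once [e] is
     reflexivity. *)
  by move: (dd_match c1) => m; case: _ / e.
Qed.

Theorem mainTheorem8 (T : gt_system) (D : language (gts_sig T)) :
  (forall (r1 r2 : rule (gts_sig T)) (G H1 H2 : graph (gts_sig T))
     (d1 : dderivation r1 G H1) (d2 : dderivation r2 G H2),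
     gts_rules r1 -> gts_rules r2 ->
     critical_pair d1 d2 -> lang_hat D G ->
     strongly_joinable d1 d2) ->
  locally_confluent_up_to_garbage D.
Proof.
move=> joinable G H1 H2 DG [[r1 R1 d1]] [[r2 R2 d2]].
case: (classic (parallelly_independent d1 d2)) => [ind|dep].
  have [M [[d1'] [d2']]] := church_rosser ind.
  by exists M; split; constructor; apply/DerivSteps/Steps1; [exists r2|exists r1].
case: (classic (exists e : r1 = r2,
    eq_rect r1 (fun r => hom (lhs r) G) (dd_match d1) r2 e = dd_match d2)) => [[e]|neq].
  subst r2 => /= /dd_unique [f fB]; exists H2; split; constructor.
  - exact: DerivIso fB.
  - by apply: (@DerivIso _ _ _ (hom_id H2)); split; exists id.
have [A [AV AE]] := match_union_subgraph (dd_match d1) (dd_match d2).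
have [||K1 [c1 c1m]] := @dd_restrict _ _ _ _ d1 A.
- by move=> x; apply/AV; left; exists x.
- by move=> x; apply/AE; left; exists x.
have [||K2 [c2 c2m]] := @dd_restrict _ _ _ _ d2 A.
- by move=> x; apply/AV; right; exists x.
- by move=> x; apply/AE; right; exists x.
have crit : critical_pair c1 c2.
  apply: (critical_pair_restrict _ _ c1m c2m dep).
  - by move=> v /AV.
  - by move=> e /AE.
  - by move=> e eE; apply: neq; exists e.
have [|M [e1 [e2 tr]]] := joinable _ _ _ _ _ c1 c2 R1 R2 crit.
  by move=> L DL subL; apply: subL; apply: DL.
(* The boundary predicate is persistence in boolean form. *)
have [|C [a [f [fB aP fa]]]] := @subgraph_context _ G A
    (fun v => (dd_track c1 v != None) && (dd_track c2 v != None)).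
  move=> e v eA ve; apply/andP; split.
  - exact: dd_restrict_track c1m eA ve.
  - exact: dd_restrict_track c2m eA ve.
(* For each boundary node, [m] records its tracks in [K1] and [K2] and their common value in [M],
   which strong joinability provides. *)
have /fin_all_exists [m mP] : forall w, exists x : node K1 * node K2 * node M,
    [/\ dd_track c1 (a w) = Some x.1.1, dd_track c2 (a w) = Some x.1.2,
        deriv_track e1 x.1.1 = Some x.2 & deriv_track e2 x.1.2 = Some x.2].
  move=> w; have /andP [/eqP t1 /eqP t2] := aP w.
  have [z [z1 z2]] := tr _ (conj t1 t2).
  case: (dd_track c1 (a w)) z1 => //= x1 z1.
  by case: (dd_track c2 (a w)) z2 => //= x2 z2; exists (x1, x2, z).
pose a1 w := (m w).1.1; pose a2 w := (m w).1.2; pose aM w := (m w).2.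
(* The extended restricted step, moved along [f], has the match of [d1]; uniqueness of results
   identifies its target with [H1]. *)
have iso1 : isomorphic H1 (ext a1).
  have [|d dm] := @ext_dd _ C _ _ _ c1 a a1; first by move=> w; case: (mP w).
  have [d' d'm] := dd_bij_l d fB; apply: (@dd_unique _ _ _ _ _ d1 d').
  by rewrite d'm dm -c1m -fa; apply: hom_ext.
have iso2 : isomorphic H2 (ext a2).
  have [|d dm] := @ext_dd _ C _ _ _ c2 a a2; first by move=> w; case: (mP w).
  have [d' d'm] := dd_bij_l d fB; apply: (@dd_unique _ _ _ _ _ d2 d').
  by rewrite d'm dm -c2m -fa; apply: hom_ext.
exists (ext aM); split.
- by apply: derives_iso_l iso1 (@ext_derives _ C _ _ e1 _ _ _) => w; case: (mP w).
- by apply: derives_iso_l iso2 (@ext_derives _ C _ _ e2 _ _ _) => w; case: (mP w).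
Qed.
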